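(* Let $R=\{(0,0),(0,1),(1,0),(1,1),(1,2),(1,3),(2,1),(2,2),(2,3),(3,1),(3,2)\}$. Then the mesh patterns $(123,R)$ and $(132,R)$ are equidistributed, i.e. $(123,R)\sim_d(132,R)$.
   Context: $S_n$ denotes the set of permutations of $[n]=\{1,\dots,n\}$, written in one-line notation $\pi=\pi_1\cdots\pi_n$. A mesh pattern of length $k$ is a pair $(\tau,R)$ with $\tau\in S_k$ and $R\subseteq\{0,1,\dots,k\}^2$; an element $(a,b)\in R$ is a shaded box (the unit square $[a,a+1]\times[b,b+1]$ in the diagram of $\tau$ with points $(i,\tau_i)$). An occurrence of $(\tau,R)$ in $\pi\in S_n$ is a choice of indices $i_1<\dots<i_k$ such that $\pi_{i_1}\cdots\pi_{i_k}$ is order-isomorphic to $\tau$ and, with $i_0=0$, $i_{k+1}=n+1$, and $v_1<\dots<v_k$ the values $\pi_{i_1},\dots,\pi_{i_k}$ sorted increasingly, $v_0=0$, $v_{k+1}=n+1$, for every $(a,b)\in R$ there is no index $m$ with $i_a<m<i_{a+1}$ and $v_b<\pi_m<v_{b+1}$. Two mesh patterns $p,q$ are equidistributed, $p\sim_d q$, if for all $n,\ell\ge 0$ the number of $\pi\in S_n$ with exactly $\ell$ occurrences of $p$ equals the number of $\pi\in S_n$ with exactly $\ell$ occurrences of $q$. *)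

(* Defs.v *)
From mathcomp Require Import all_boot all_fingroup.
Set Implicit Arguments.
Unset Strict Implicit.
Unset Printing Implicit Defensive.

(* Permutations of [n] are elements of 'S_n: positions and values are
   0-based, i.e. s : 'S_n has one-line notation (s 0).+1, ..., (s n.-1).+1. *)

Record mesh_pattern (k : nat) := MeshPattern {
  mesh_perm : 'S_k;
  mesh_boxes : {set 'I_k.+1 * 'I_k.+1}
}.

Section Occurrences.
Variables (k n : nat) (p : mesh_pattern k) (s : 'S_n).

(* A choice of k indices is a map f : 'I_k -> 'I_n, required below to be
   strictly increasing. The two grid sequences are 1-based: they are
   0 = i_0, i_1, ..., i_k, i_{k+1} = n + 1 and
   0 = v_0, v_1, ..., v_k, v_{k+1} = n + 1. *)
Definition index_grid (f : {ffun 'I_k -> 'I_n}) : seq nat :=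
  0 :: rcons [seq (f j).+1 | j <- enum 'I_k] n.+1.

Definition value_grid (f : {ffun 'I_k -> 'I_n}) : seq nat :=
  0 :: rcons (sort leq [seq (s (f j)).+1 | j <- enum 'I_k]) n.+1.

Definition in_box (f : {ffun 'I_k -> 'I_n}) (a b : nat) (m : 'I_n) : bool :=
  (nth 0 (index_grid f) a < m.+1 < nth 0 (index_grid f) a.+1) &&
  (nth 0 (value_grid f) b < (s m).+1 < nth 0 (value_grid f) b.+1).

Definition is_occurrence (f : {ffun 'I_k -> 'I_n}) : bool :=
  [&& [forall i : 'I_k, forall j : 'I_k, (i < j) ==> (f i < f j)],
      [forall i : 'I_k, forall j : 'I_k,
         (s (f i) < s (f j)) == (mesh_perm p i < mesh_perm p j)] &
      [forall ab in mesh_boxes p, forall m : 'I_n,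
         ~~ in_box f ab.1 ab.2 m]].

Definition occurrences : nat := #|[set f | is_occurrence f]|.

End Occurrences.

Definition equidistributed (k k' : nat)
    (p : mesh_pattern k) (q : mesh_pattern k') : Prop :=
  forall n l : nat,
    #|[set s : 'S_n | occurrences p s == l]| =
    #|[set s : 'S_n | occurrences q s == l]|.

Definition boxes (k : nat) (r : seq (nat * nat)) : {set 'I_k.+1 * 'I_k.+1} :=
  [set ab | (val ab.1, val ab.2) \in r].

Definition perm123 : 'S_3 := 1%g.

Definition perm132 : 'S_3 :=
  tperm (@Ordinal 3 1 isT) (@Ordinal 3 2 isT).

(* Main.v *)
(** In both patterns the first two points are adjacent, and an occurrence is
determined by its first point: i must be a strict left-to-right minimum such
that, among the entries to the right of i that exceed s i, the first two in
position order are the two smallest, the first of them sits at i+1, and the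
minimum is s i + 1. It is an occurrence of 123 or of 132 according to the
relative order of these two entries. Exchanging them is an involution that
turns an occurrence at i of one pattern into an occurrence at i of the other,
and leaves the status of every other position unchanged. Performing this
exchange at all positions successively is therefore a bijection of S_n that
turns the occurrences of 132 into those of 123. *)
Require Import Defs.
From mathcomp Require Import all_boot all_fingroup.
From mathcomp Require Import zify.
Set Implicit Arguments.
Unset Strict Implicit.
Unset Printing Implicit Defensive.

(** * Exchanging the two upper points of an occurrence *)

Section Swaps.
Variable n : nat.
Implicit Types (s : 'S_n) (i j k m x : 'I_n) (d : bool).

(* Seals the coercions from permutations to functions and from ordinals to nat,
   whose several convertible forms [lia] does not identify. *)
Definition value s x : nat := s x.

Lemma value_inj s : injective (value s).
Proof. exact: inj_comp val_inj perm_inj. Qed.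

Definition swap j k s : 'S_n := (tperm j k * s)%g.

Lemma swapE j k s x : value (swap j k s) x = value s (tperm j k x).
Proof. by rewrite /value permM. Qed.

Lemma swapK j k : involutive (swap j k).
Proof. by move=> s; rewrite /swap mulgA tperm2 mul1g. Qed.

(* [(i, j, k)] are the positions of an occurrence of one of the two patterns,
   which one being left open. *)
Definition core s i j k : bool :=
  [&& j == i.+1 :> nat, j < k, minn (value s j) (value s k) == (value s i).+1 &
    [forall m : 'I_n, [&& (m < i) ==> (value s i < value s m),
       (j < m < k) ==> (value s m < value s i) &
       (k < m) ==> (value s m < value s i) ||
                   (maxn (value s j) (value s k) < value s m)]]].

(** The boolean [d] selects the pattern: [true] stands for 123, [false] for 132. *)
Definition occurs_at d s i : bool :=
  [exists j, exists k, core s i j k && ((value s j < value s k) == d)].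

Definition swap_at i s : 'S_n :=
  if [pick jk | core s i jk.1 jk.2] is Some jk then swap jk.1 jk.2 s
  else s.

Lemma coreP s i j k :
  reflect [/\ j = i.+1 :> nat, j < k,
      minn (value s j) (value s k) = (value s i).+1 &
      forall m, [/\ m < i -> value s i < value s m,
        j < m < k -> value s m < value s i &
        k < m -> value s m < value s i \/
                 maxn (value s j) (value s k) < value s m]]
    (core s i j k).
Proof.
apply: (iffP and4P) => -[/eqP-> -> /eqP-> H]; split=> //.
  move=> m; have /and3P[h1 h2 h3] := forallP H m.
  by split; [exact/implyP|exact/implyP|move/(implyP h3)/orP].
apply/forallP=> m; have [h1 h2 h3] := H m.
by apply/and3P; split; apply/implyP=> // /h3/orP.
Qed.

Lemma ord_neq i j : i <> j -> i <> j :> nat.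
Proof. by move=> ij /val_inj. Qed.

Lemma value_neq s i j : (i <> j :> nat) -> (value s i <> value s j :> nat).
Proof. by move=> ij /value_inj eq_ij; apply: ij; rewrite eq_ij. Qed.

(** Indeed [k] is the first position after [j] whose entry exceeds that at [i]. Hence the choice
    made by [pick] in [swap_at] is forced. *)
Lemma core_uniq s i j k j' k' :
  core s i j k -> core s i j' k' -> j = j' /\ k = k'.
Proof.
move=> /coreP[ji jk v H] /coreP[ji' jk' v' H'].
have [_ h _] := H k'; have [_ h' _] := H' k.
by split; apply: val_inj => /=; lia.
Qed.

(** The entries at [j] and [k] enter [core] only through their minimum and maximum. *)
Lemma core_swap s i j k : core s i j k -> core (swap j k s) i j k.
Proof.
move=> /coreP[ji jk v H].
have ij : tperm j k i = i by rewrite tpermD //; apply/eqP => /(congr1 val) /=; lia.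
apply/coreP; split; rewrite ?swapE ?tpermL ?tpermR ?ij //; first by lia.
move=> m; have := H m; rewrite swapE.
by case: tpermP => [->|->|_ _] [h1 h2 h3]; split; lia.
Qed.

(** Both exchanged entries exceed [s i], which exceeds [s i']. So [i'] is neither [j] nor [k] and
    lies right of [j]; of the exchanged positions only [k] can be [j'] or [k']. *)
Lemma core_swap_later s i j k i' j' k' : i < i' ->
  core s i j k -> core s i' j' k' -> core (swap j k s) i' j' k' /\
  (value (swap j k s) j' < value (swap j k s) k') = (value s j' < value s k').
Proof.
move=> ii' /coreP[ji jk v H] /coreP[ji' jk' v' H'].
have [ii'' _ _] := H' i.
have v'i : value s i' < value s i by apply: ii''.
have ni'j : i' <> j :> nat by move=> /val_inj E; move: v'i; rewrite E; lia.
have ni'k : i' <> k :> nat by move=> /val_inj E; move: v'i; rewrite E; lia.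
have ti' : tperm j k i' = i'.
  by rewrite tpermD //; apply/eqP => /(congr1 val) /=; lia.
(* No other entry right of [j] lies between the two exchanged ones, so giving [k] the entry of [j]
   alters no comparison among positions right of [j]. *)
have tx x : j < x -> (x = k /\ tperm j k x = j) \/
    [/\ x <> k :> nat, tperm j k x = x &
        value s x < value s i \/ maxn (value s j) (value s k) < value s x].
  move=> jx; case: tpermP => [E|->|_ nxk]; [by move: jx; rewrite E ltnn|by left|].
  have nxk' : x <> k :> nat by move/val_inj.
  by right; split=> //; have [_] := H x; lia.
have jj' : j < j' by lia.
have jk2 : j < k' by lia.
have tj := tx _ jj'; have tk := tx _ jk2.
split; last first.
  rewrite !swapE; clear H H' tx ii''.
  by case: tj => [[? ->]|[? -> ?]]; case: tk => [[? ->]|[? -> ?]]; subst; apply/idP/idP; lia.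
apply/coreP; split=> //; rewrite ?swapE ?ti'.
  clear H H' tx ii''.
  by case: tj => [[? ->]|[? -> ?]]; case: tk => [[? ->]|[? -> ?]]; subst; lia.
move=> m; have [b1 b2 b3] := H' m; have tm := tx m.
have [_ dk ek] := H' k; clear H H' tx ii''; rewrite !swapE.
split=> [mi'|/andP[j'm mk']|k'm].
- by clear dk ek b2 b3 tj tk tm; case: tpermP => [E|E|_ _]; [lia|lia|exact: b1].
- have jm : j < m by lia.
  by case: (tm jm) => [[E ->]|[_ -> _]]; [subst|]; lia.
have {tm} := tm (ltn_trans jk2 k'm); have {b3} := b3 k'm; clear b1 b2 dk.
case: tj => [[? ->]|[? -> ?]]; case: tk => [[? ->]|[? -> ?]];
  move=> b3 [[? ->]|[? -> ?]]; subst; lia.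
Qed.

(** The third point follows its entry, whence [tperm j k k']. The smaller exchanged entry is
    [s i + 1], below [s i'], so it may sit on either side of the third point. If [k'] is neither [j]
    nor [k], it does not lie between them, since entries there are below [s i]. *)
Lemma core_swap_earlier s i j k i' j' k' : i' < i ->
  core s i j k -> core s i' j' k' ->
  core (swap j k s) i' j' (tperm j k k') /\
  (value (swap j k s) j' < value (swap j k s) (tperm j k k')) = (value s j' < value s k').
Proof.
move=> ii' /coreP[ji jk v H] /coreP[ji' jk' v' H'].
have [ii'' _ _] := H i'.
have v'i : value s i < value s i' by apply: ii''.
have nij' : i <> j' :> nat by move=> /val_inj E; move: v'i; rewrite E; lia.
have nik' : i <> k' :> nat by move=> /val_inj E; move: v'i; rewrite E; lia.
have ti' : tperm j k i' = i'.
  by rewrite tpermD //; apply/eqP => /(congr1 val) /=; lia.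
have tj' : tperm j k j' = j'.
  by rewrite tpermD //; apply/eqP => /(congr1 val) /=; lia.
have j'j : j' < j by lia.
rewrite !swapE tpermK tj'; split=> //.
have jk'' : j' < tperm j k k' by clear - jk j'j jk'; case: tpermP => [E|E|_ _]; lia.
have ni'k := @value_neq s i' k.
apply/coreP; split; rewrite ?swapE ?tpermK ?ti' ?tj' //.
move=> m; rewrite !swapE.
have [_ aj bj] := H' j; have [_ ak bk] := H' k; have [_ ak' _] := H k'.
have [am bm cm] := H' m; have [_ dm _] := H m.
clear H H'; split=> [mi'|/andP[j'm mk]|km].
- clear - mi' am ji jk ji' j'j.
  by move: mi'; case: tpermP => [->|->|_ _] mi'; [lia|lia|exact: am].
- clear am cm; move: mk.
  case: (tpermP _ _ k') => [E|E|/ord_neq E /ord_neq E']; subst.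
  + by clear ak bk; case: tpermP => [->|->|/ord_neq A /ord_neq B] mk; lia.
  + by clear ak' bk dm; case: tpermP => [->|->|/ord_neq A /ord_neq B] mk; lia.
  + by clear dm; case: tpermP => [->|->|/ord_neq A /ord_neq B] mk; lia.
- clear am dm; move: km.
  case: (tpermP _ _ k') => [E|E|/ord_neq E /ord_neq E']; subst.
  + by case: tpermP => [->|->|/ord_neq A /ord_neq B] km; lia.
  + by case: tpermP => [->|->|/ord_neq A /ord_neq B] km; lia.
  + by case: tpermP => [->|->|/ord_neq A /ord_neq B] km; lia.
Qed.

Lemma swap_at_core s i j k :
  core s i j k -> swap_at i s = swap j k s.
Proof.
rewrite /swap_at => c; case: pickP => [[j' k'] /= c'|/(_ (j, k))]; last by rewrite c.
by have [-> ->] := core_uniq c c'.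
Qed.

Lemma swap_atK i : involutive (swap_at i).
Proof.
move=> s; case E: [pick jk | core s i jk.1 jk.2] => [jk|]; last by rewrite /swap_at !E.
have c : core s i jk.1 jk.2 by move: E; case: pickP => // x c [<-].
by rewrite (swap_at_core c) (swap_at_core (core_swap c)) swapK.
Qed.

Lemma occurs_swap_at d i s i' :
  occurs_at d (swap_at i s) i' = occurs_at (d (+) (i' == i)) s i'.
Proof.
(* One implication suffices because [swap_at i] is an involution. *)
suff H d' s' : occurs_at d' s' i' -> occurs_at (d' (+) (i' == i)) (swap_at i s') i'.
  apply/idP/idP => [/H|/H]; first by rewrite swap_atK.
  by rewrite -addbA addbb addbF.
move=> /existsP[j' /existsP[k' /andP[c' /eqP <-]]].
rewrite /swap_at; case: pickP => [[j k] /= c|none]; last first.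
  have [E|_] := eqVneq i' i; first by have := none (j', k'); rewrite /= -E c'.
  by rewrite addbF; apply/existsP; exists j'; apply/existsP; exists k'; rewrite c' eqxx.
have [E|ne] := eqVneq i' i.
  rewrite E in c' *; have [Ej Ek] := core_uniq c c'; subst j' k'.
  apply/existsP; exists j; apply/existsP; exists k.
  rewrite core_swap // !swapE tpermL tpermR addbT -leqNgt leq_eqVlt.
  have /coreP[_ jk _ _] := c.
  have := @value_neq s' j k.
  by case: eqP => //= E'; lia.
rewrite addbF; have := ne; rewrite neq_ltn => /orP[lt|lt].
  have [c2 <-] := core_swap_earlier lt c c'.
  by apply/existsP; exists j'; apply/existsP; exists (tperm j k k'); rewrite c2 eqxx.
have [c2 <-] := core_swap_later lt c c'.
by apply/existsP; exists j'; apply/existsP; exists k'; rewrite c2 eqxx.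
Qed.

(** * The exchange at all positions *)

Definition swap_all s : 'S_n := foldr swap_at s (enum 'I_n).

Lemma swap_all_inj : injective swap_all.
Proof.
rewrite /swap_all; elim: (enum _) => [|i r IHr] s t //=.
by move/(can_inj (swap_atK i))/IHr.
Qed.

Lemma occurs_swap_all d s i : occurs_at d (swap_all s) i = occurs_at (~~ d) s i.
Proof.
(* Without repetitions, each listed position is flipped exactly once, whatever the order of the
   list. *)
have H r : uniq r ->
    forall d, occurs_at d (foldr swap_at s r) i = occurs_at (d (+) (i \in r)) s i.
  elim: r => [|i' r IHr] /=; first by move=> _ d'; rewrite addbF.
  move=> /andP[nr /IHr {}IHr] d'; rewrite occurs_swap_at IHr inE -addbA.
  by congr (occurs_at (d' (+) _) s i); case: eqP nr => // -> /negbTE->.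
by rewrite H ?enum_uniq // mem_enum addbT.
Qed.

End Swaps.

(** * From mesh patterns to cores *)

Definition shaded_boxes :=
  [:: (0, 0); (0, 1); (1, 0); (1, 1); (1, 2); (1, 3);
      (2, 1); (2, 2); (2, 3); (3, 1); (3, 2)].

Definition pattern d :=
  MeshPattern (if d then perm123 else perm132) (boxes 3 shaded_boxes).

Local Definition o0 : 'I_3 := @Ordinal 3 0 isT.
Local Definition o1 : 'I_3 := @Ordinal 3 1 isT.
Local Definition o2 : 'I_3 := @Ordinal 3 2 isT.

Lemma forall_ord3 (P : pred 'I_3) : [forall i, P i] = [&& P o0, P o1 & P o2].
Proof.
apply/forallP/and3P => [H|[H0 H1 H2] [[|[|[|//]]] lt]]; first by split.
- by rewrite (_ : Ordinal lt = o0) //; apply: val_inj.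
- by rewrite (_ : Ordinal lt = o1) //; apply: val_inj.
- by rewrite (_ : Ordinal lt = o2) //; apply: val_inj.
Qed.

Lemma enum_ord3 : enum 'I_3 = [:: o0; o1; o2].
Proof. by apply: (inj_map val_inj); rewrite val_enum_ord. Qed.

Lemma forall_boxes k (r : seq (nat * nat)) (P : nat -> nat -> bool) :
  all (fun ab => (ab.1 <= k) && (ab.2 <= k)) r ->
  [forall ab in boxes k r, P ab.1 ab.2] = all (fun ab => P ab.1 ab.2) r.
Proof.
move=> /allP lt; apply/forall_inP/allP => [H [a b] abr|H ab].
  have /andP[/= ltak ltbk] := lt _ abr.
  by apply: (H (@Ordinal k.+1 a ltak, @Ordinal k.+1 b ltbk)); rewrite inE.
by rewrite inE => /H.
Qed.

Section Occurrences.
Variable n : nat.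
Implicit Types (s : 'S_n) (f : {ffun 'I_3 -> 'I_n}) (d : bool).

Lemma index_grid3 f :
  index_grid f = [:: 0; (f o0).+1; (f o1).+1; (f o2).+1; n.+1].
Proof. by rewrite /index_grid enum_ord3. Qed.

(** With the first point lowest, as in both patterns, only the last two values remain to be
    sorted. *)
Lemma value_grid3 s f :
    value s (f o0) < minn (value s (f o1)) (value s (f o2)) ->
  value_grid s f = [:: 0; (value s (f o0)).+1;
    (minn (value s (f o1)) (value s (f o2))).+1;
    (maxn (value s (f o1)) (value s (f o2))).+1; n.+1].
Proof.
rewrite /value_grid enum_ord3 /= -!/(value _ _).
set x := value _ _; set y := value _ _; set z := value _ _ => lt.
have -> // : sort leq [:: x.+1; y.+1; z.+1] = [:: x.+1; (minn y z).+1; (maxn y z).+1].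
apply: (sorted_eq leq_trans anti_leq); first exact: sort_sorted leq_total _.
  by rewrite /=; lia.
rewrite perm_sort perm_cons; case: leqP => _ //.
by rewrite (perm_catC [:: y.+1] [:: z.+1]).
Qed.

Lemma mesh_perm_pattern d :
  [seq val (mesh_perm (pattern d) x) | x <- [:: o0; o1; o2]] =
  if d then [:: 0; 1; 2] else [:: 0; 2; 1].
Proof. by case: d; rewrite /= ?perm1 // /perm132 !permE. Qed.

Lemma is_occurrence_pattern d s f :
  is_occurrence (pattern d) s f =
  [&& f o0 < f o1, f o1 < f o2,
      value s (f o0) < minn (value s (f o1)) (value s (f o2)),
      (value s (f o1) < value s (f o2)) == d &
      all (fun ab => [forall m, ~~ in_box s f ab.1 ab.2 m]) shaded_boxes].
Proof.
rewrite /is_occurrence !forall_ord3.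
rewrite (forall_boxes (fun a b => [forall m, ~~ in_box s f a b m])) //.
case: (all _ _); last by rewrite !andbF.
(* Read as 0 or 1, [d] gives the last two values: 1, 2 for 123 and 2, 1 for 132. *)
have [-> -> ->] : [/\ mesh_perm (pattern d) o0 = 0 :> nat,
    mesh_perm (pattern d) o1 = 2 - d :> nat &
    mesh_perm (pattern d) o2 = 1 + d :> nat].
  by case: d (mesh_perm_pattern d) => -[-> -> ->].
have [lt01|_] := ltnP (f o0) (f o1); last by rewrite !andbF.
have [lt12|_] := ltnP (f o1) (f o2); last by rewrite !andbF.
have neq12 : f o1 <> f o2 :> nat by lia.
have := value_neq (s := s) neq12.
rewrite (ltn_trans lt01 lt12) leq_min -!/(value _ _) /= !ltnn /=.
set y := value _ (f o1); set z := value _ (f o2); set x := value _ _ => neq_yz.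
by case: (ltngtP x y) => _; case: (ltngtP x z) => _; case: (ltngtP y z) => // _;
  case: d.
Qed.

Lemma is_occurrence_core d s f :
  is_occurrence (pattern d) s f =
  core s (f o0) (f o1) (f o2) &&
  ((value s (f o1) < value s (f o2)) == d).
Proof.
rewrite is_occurrence_pattern; case: (_ == d); last by rewrite !andbF.
have box_free a b : reflect (forall m : 'I_n,
    ~~ [&& nth 0 (index_grid f) a < m.+1, m.+1 < nth 0 (index_grid f) a.+1,
      nth 0 (value_grid s f) b < (value s m).+1 &
      (value s m).+1 < nth 0 (value_grid s f) b.+1])
    [forall m, ~~ in_box s f a b m].
  by apply: (iffP forallP) => H m; have := H m; rewrite /in_box -!andbA.
have value_lt m : value s m < n := ltn_ord (s m).
rewrite andbT andTb; apply/and4P/idP => [[ij jk iv /allP free]|].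
  have {}free a b : (a, b) \in shaded_boxes -> _ :=
    fun ab => box_free a b (free _ ab).
  rewrite index_grid3 (value_grid3 iv) in free.
  move: (f o0) (f o1) (f o2) ij jk iv free => i j k ij jk iv free.
  (* If [j] were further right, the point at position [i + 1] would lie in column 1, which is
     entirely shaded. *)
  have adj : j = i.+1 :> nat.
    have lt : i.+1 < n by have := ltn_ord j; lia.
    pose m := Ordinal lt; have mE : m = i.+1 :> nat by [].
    have := free 1 0 isT m; have := free 1 1 isT m; have := free 1 2 isT m.
    have := free 1 3 isT m; clear free => /=.
    have := @value_neq _ s m i; have := @value_neq _ s m j.
    have := @value_neq _ s m k; have := value_lt m; clearbody m.
    by clear box_free value_lt; lia.
  (* Likewise for the point of value [s i + 1] and row 1, also entirely shaded. *)
  have minE : minn (value s j) (value s k) = (value s i).+1.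
    have lt : (value s i).+1 < n by have := value_lt j; lia.
    have [m mE] : exists m, value s m = (value s i).+1.
      by exists (s^-1%g (Ordinal lt)); rewrite /value permKV.
    have := free 0 1 isT m; have := free 1 1 isT m; have := free 2 1 isT m.
    have := free 3 1 isT m; clear free => /=.
    have neq x : value s x <> (value s i).+1 -> m <> x :> nat.
      by move=> neq_x /val_inj eq_mx; apply: neq_x; rewrite -eq_mx.
    have := neq i; have := neq j; have := neq k; have := ltn_ord m.
    by clear neq box_free value_lt; lia.
  apply/coreP; split=> // m; split=> [mi|/andP[jm mk]|km].
  - have := free 0 0 isT m; have := @value_neq _ s m i; clear free box_free => /=.
    by lia.
  - have := free 2 1 isT m; have := free 2 2 isT m; have := free 2 3 isT m.
    have := @value_neq _ s m i; have := @value_neq _ s m j.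
    have := @value_neq _ s m k; have := value_lt m.
    by clear free box_free value_lt => /=; lia.
  - have := free 3 1 isT m; have := free 3 2 isT m.
    have := @value_neq _ s m i; have := @value_neq _ s m j.
    have := @value_neq _ s m k; have := ltn_ord m.
    by clear free box_free value_lt => /=; lia.
move=> /coreP[ji jk v H].
have iv : value s (f o0) < minn (value s (f o1)) (value s (f o2)) by lia.
split=> //; first by lia.
apply/allP => -[a b] ab; apply/box_free; rewrite index_grid3 value_grid3 // => m.
have [h1 h2 h3] := H m; clear box_free H value_lt iv; move: ab; rewrite !inE.
by do ![case/orP=> [/eqP[-> ->] /=|]; first by lia]; move/eqP=> [-> ->] /=; lia.
Qed.

(** An occurrence can be counted by its first position, since [core_uniq] recovers the other two. *)
Lemma occurrences_pattern d s :
  occurrences (pattern d) s = #|[set i | occurs_at d s i]|.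
Proof.
rewrite /occurrences -(card_in_imset (f := fun f : {ffun 'I_3 -> 'I_n} => f o0)).
  apply: eq_card => i; rewrite inE; apply/imsetP/existsP => [[f]|[j /existsP[k c]]].
    rewrite inE is_occurrence_core => c ->.
    by exists (f o1); apply/existsP; exists (f o2).
  exists [ffun x : 'I_3 => nth i [:: i; j; k] x]; last by rewrite ffunE.
  by rewrite inE is_occurrence_core !ffunE.
move=> f g; rewrite !inE !is_occurrence_core => /andP[cf _] /andP[cg _] e0.
rewrite -e0 in cg; have [e1 e2] := core_uniq cf cg.
apply/ffunP => x; apply/eqP; move: x; apply/forallP.
by rewrite forall_ord3 e0 e1 e2 !eqxx.
Qed.

End Occurrences.

Theorem theorem2p1 :
  let R := boxes 3 [:: (0, 0); (0, 1); (1, 0); (1, 1); (1, 2); (1, 3);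
                       (2, 1); (2, 2); (2, 3); (3, 1); (3, 2)] in
  equidistributed (MeshPattern perm123 R) (MeshPattern perm132 R).
Proof.
(* The set for 132 has as many elements as its preimage under the injective [swap_all], which is the
   set for 123. *)
move=> R n l; rewrite -[RHS](card_preimset _ (@swap_all_inj n)).
apply: eq_card => s; rewrite !inE.
rewrite -[MeshPattern perm123 R]/(pattern true).
rewrite -[MeshPattern perm132 R]/(pattern false).
rewrite !occurrences_pattern; congr (_ == l).
by apply: eq_card => i; rewrite !inE occurs_swap_all.
Qed.
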